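(* Let $G$ be a connected graph with vertex set $V=\{1,\ldots,n\}$, and let $\lambda_1\ge\cdots\ge\lambda_{n-1}\ge\lambda_n=0$ be the eigenvalues of its Laplacian matrix. For distinct vertices $i,k$ define $$\alpha_{ik}=\begin{cases}-d_i+2N(i,k)+1,& k\sim i,\\ -d_i+2N(i,k),& k\nsim i,\end{cases}\qquad \beta_{ik}=\begin{cases}d_i+2d_k-2N(i,k)-1,& k\sim i,\\ d_i+2d_k-2N(i,k),& k\nsim i.\end{cases}$$ Then $$\max_{i\in V}\min_{k\neq i}\alpha_{ik}\le\lambda_{n-1}\le\lambda_1\le\min_{i\in V}\max_{k\neq i}\beta_{ik}.$$
   Context: Graphs are simple, finite and undirected; $k\sim i$ means $k,i$ adjacent. $d_i$ is the degree of vertex $i$ and $N(i,k)$ the number of common neighbours of distinct vertices $i,k$. The Laplacian matrix is $L=D-A$ with $A$ the adjacency matrix and $D$ the diagonal degree matrix. *)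

(* Defs.v *)
From mathcomp Require Import all_boot all_order all_algebra.

Set Implicit Arguments.
Unset Strict Implicit.
Unset Printing Implicit Defensive.

Import Order.TTheory GRing.Theory Num.Theory.
Local Open Scope ring_scope.

(* Maximum and minimum of [F] over the nonempty finite set [P]; the value 0
   for empty [P] is junk.  An element of [P] is used as the starting point of
   the iterated max/min, so that no extraneous default value takes part. *)
Definition fin_max (R : realDomainType) (I : finType) (P : pred I)
    (F : I -> R) : R :=
  if [pick i | P i] is Some i0 then \big[Num.max/F i0]_(i | P i) F i else 0.

Definition fin_min (R : realDomainType) (I : finType) (P : pred I)
    (F : I -> R) : R :=
  if [pick i | P i] is Some i0 then \big[Num.min/F i0]_(i | P i) F i else 0.

Lemma fin_maxP (R : realDomainType) (I : finType) (P : pred I) (F : I -> R)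
    (i0 : I) : P i0 ->
  (exists2 i, P i & fin_max P F = F i) /\ (forall i, P i -> F i <= fin_max P F).
Proof.
rewrite /fin_max => Pi0; case: pickP => [i1 Pi1|/(_ i0)]; last by rewrite Pi0.
split=> [|i Pi]; last exact: le_bigmax_cond.
by elim/big_rec: _ => [|i x Pi [j Pj ->]]; [exists i1 | case: leP; [exists j | exists i]].
Qed.

Lemma fin_minP (R : realDomainType) (I : finType) (P : pred I) (F : I -> R)
    (i0 : I) : P i0 ->
  (exists2 i, P i & fin_min P F = F i) /\ (forall i, P i -> fin_min P F <= F i).
Proof.
rewrite /fin_min => Pi0; case: pickP => [i1 Pi1|/(_ i0)]; last by rewrite Pi0.
split=> [|i Pi]; last exact: bigmin_le_cond.
by elim/big_rec: _ => [|i x Pi [j Pj ->]]; [exists i1 | case: leP; [exists i | exists j]].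
Qed.

(* A simple graph on [T] is a symmetric irreflexive relation [e : rel T]. *)
Definition degree (T : finType) (e : rel T) (i : T) : nat :=
  #|[set k | e i k]|.

Definition common_nbrs (T : finType) (e : rel T) (i k : T) : nat :=
  #|[set j | e i j && e k j]|.

Definition connected_graph (T : finType) (e : rel T) : Prop :=
  forall x y : T, connect e x y.

Definition adjacency_mx (R : pzRingType) (n : nat) (e : rel 'I_n) : 'M[R]_n :=
  \matrix_(i, j) (e i j)%:R.

Definition degree_mx (R : pzRingType) (n : nat) (e : rel 'I_n) : 'M[R]_n :=
  diag_mx (\row_i (degree e i)%:R).

Definition laplacian_mx (R : pzRingType) (n : nat) (e : rel 'I_n) : 'M[R]_n :=
  degree_mx R e - adjacency_mx R e.

(* [s] lists the eigenvalues of [M], with algebraic multiplicity, in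
   nonincreasing order. *)
Definition eigenvalues_of (R : realDomainType) (n : nat) (M : 'M[R]_n)
    (s : n.-tuple R) : Prop :=
  sorted >=%R s /\ char_poly M = \prod_(x <- s) ('X - x%:P).

Definition alpha (R : pzRingType) (T : finType) (e : rel T) (i k : T) : R :=
  if e k i then - (degree e i)%:R + 2 * (common_nbrs e i k)%:R + 1
  else - (degree e i)%:R + 2 * (common_nbrs e i k)%:R.

Definition beta (R : pzRingType) (T : finType) (e : rel T) (i k : T) : R :=
  if e k i then
    (degree e i)%:R + 2 * (degree e k)%:R - 2 * (common_nbrs e i k)%:R - 1
  else (degree e i)%:R + 2 * (degree e k)%:R - 2 * (common_nbrs e i k)%:R.

(* Main.v *)
(** Fix a vertex [i].  Since the rows of the Laplacian [L] sum to 0, subtracting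
    row [i] from the other rows, and then adding all columns to column [i], is a
    similarity that splits off the eigenvalue 0 and leaves the matrix
    [B k j = L k j - L i j] indexed by the vertices other than [i].  As [L] is
    positive semidefinite (Gershgorin), the eigenvalues of [B] are
    [lambda_1, ..., lambda_(n-1)], and the two bounds are Gershgorin's
    inequalities for the rows of [B]: off the diagonal, row [k] of [B] is the
    difference of the indicators of the neighbourhoods of [i] and [k]. *)
Require Import Defs.
From mathcomp Require Import all_boot all_order all_algebra.
From mathcomp Require Import ring lra.

Set Implicit Arguments.
Unset Strict Implicit.
Unset Printing Implicit Defensive.

Import Order.TTheory GRing.Theory Num.Theory.
Local Open Scope ring_scope.

Lemma char_poly_trmx (R : comNzRingType) (n : nat) (A : 'M[R]_n) :
  char_poly A^T = char_poly A.
Proof.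
rewrite /char_poly -[RHS]det_tr; congr (\det _).
by apply/matrixP=> i j; rewrite !mxE eq_sym.
Qed.

Lemma char_poly_similar (R : comNzRingType) (n : nat) (P Q A : 'M[R]_n) :
  P *m Q = 1%:M -> char_poly (P *m A *m Q) = char_poly A.
Proof.
move=> PQ1; rewrite /char_poly.
have -> : char_poly_mx (P *m A *m Q)
    = map_mx polyC P *m char_poly_mx A *m map_mx polyC Q.
  rewrite /char_poly_mx mulmxBr mulmxBl !map_mxM /=; congr (_ - _).
  by rewrite mul_mx_scalar -scalemxAl -map_mxM PQ1 map_mx1 scalemx1.
rewrite !det_mulmx mulrAC -det_mulmx -map_mxM PQ1 map_mx1 det1.
by rewrite mul1r.
Qed.

(** Vanishing row sums make column [i] of [P *m A *m Q] zero, so its characteristic matrix has the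
    single entry ['X] in that column. *)
Lemma char_poly_row_sum0 (R : comNzRingType) (n : nat) (A : 'M[R]_n.+1)
    (i : 'I_n.+1) :
  (forall k, \sum_j A k j = 0) ->
  char_poly A =
  'X * char_poly (\matrix_(k, j) (A (lift i k) (lift i j) - A i (lift i j))).
Proof.
move=> A0.
(* Left multiplication by [P] subtracts row [i] from every other row; right multiplication by its
   inverse [Q] replaces column [i] by the sum of all columns. *)
pose P : 'M[R]_n.+1 :=
  \matrix_(k, j) ((k == j)%:R - ((j == i) && (k != i))%:R).
pose Q : 'M[R]_n.+1 := \matrix_(k, j) (if j == i then 1 else (k == j)%:R).
have PE m (M : 'M[R]_(_, m)) k j :
    (P *m M) k j = M k j - (k != i)%:R * M i j.
  rewrite mxE (eq_bigr (fun l => (k == l)%:R * M l j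
                        - (l == i)%:R * ((k != i)%:R * M l j))); last first.
    by move=> l _; rewrite mxE mulrBl -mulnb natrM mulrA.
  rewrite sumrB (bigD1 k) //= eqxx mul1r big1 ?addr0; last first.
    by move=> l /negbTE; rewrite eq_sym => ->; rewrite mul0r.
  rewrite (bigD1 i) //= eqxx mul1r big1 ?addr0 //.
  by move=> l /negbTE ->; rewrite mul0r.
have AQE k j : (A *m Q) k j = if j == i then 0 else A k j.
  rewrite mxE; case: ifP => ji.
    by rewrite -[RHS](A0 k); apply: eq_bigr => l _; rewrite mxE ji mulr1.
  rewrite (bigD1 j) //= mxE ji eqxx mulr1 big1 ?addr0 // => l /negbTE lj.
  by rewrite mxE ji lj mulr0.
have PQ1 : P *m Q = 1%:M.
  apply/matrixP=> k j; rewrite PE !mxE; case: (eqVneq j i) => [->|ji].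
    by case: eqVneq => _ /=; rewrite ?mul0r ?mul1r ?subr0 ?subrr.
  by rewrite mulr0 subr0.
have charE m (M : 'M[R]_m) k j : char_poly_mx M k j = 'X *+ (k == j) - (M k j)%:P.
  by rewrite !mxE.
rewrite -(char_poly_similar A PQ1) -mulmxA /char_poly (expand_det_col _ i).
rewrite (bigD1 i) //= big1 ?addr0 => [|k /negbTE ki]; last first.
  by rewrite charE PE !AQE eqxx mulr0 subr0 ki mulr0n subr0 mul0r.
rewrite charE PE !AQE !eqxx mulr0 !subr0 mulr1n.
set B := (X in _ = _ * \det X).
suff BE : row' i (col' i (char_poly_mx (P *m (A *m Q)))) = B.
  by rewrite /cofactor addnn -signr_odd odd_double mul1r BE.
apply/matrixP=> k j; rewrite 2!mxE !charE PE !AQE [in RHS]mxE.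
rewrite (inj_eq lift_inj) ![lift _ _ == _]eq_sym !(negbTE (neq_lift _ _)).
by rewrite mul1r.
Qed.

Lemma Gershgorin (R : realFieldType) (n : nat) (A : 'M[R]_n) (x : R) :
  root (char_poly A) x ->
  exists k, `|x - A k k| <= \sum_(j | j != k) `|A k j|.
Proof.
(* [eigenvalue] concerns row vectors acting from the left; transposing yields a right eigenvector of
   [A], hence a bound by row sums. *)
rewrite -char_poly_trmx -eigenvalue_root_char => /eigenvalueP[v vA v_neq0].
have [k0 vk0] : exists k, v 0 k != 0.
  apply/existsP; apply: contraNT v_neq0; rewrite negb_exists => /forallP v0.
  by apply/eqP/rowP=> k; move: (v0 k); rewrite negbK mxE => /eqP.
(* Row [k] is chosen where the eigenvector has its largest absolute value, so dividing by that entry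
   leaves coefficients of modulus at most 1. *)
case: (@arg_maxP _ _ _ k0 xpredT (fun k => `|v 0 k|) isT) => k _ kmax.
have vk_gt0 : 0 < `|v 0 k| by apply: lt_le_trans (kmax k0 isT); rewrite normr_gt0.
exists k; rewrite -(ler_pM2r vk_gt0) -normrM.
have -> : (x - A k k) * v 0 k = \sum_(j | j != k) A k j * v 0 j.
  move/rowP/(_ k): vA; rewrite !mxE (bigD1 k) //= mxE => vA.
  rewrite mulrBl -vA [v 0 k * _]mulrC addrAC subrr add0r.
  by apply: eq_bigr => j _; rewrite mxE mulrC.
apply: le_trans (ler_norm_sum _ _ _) _; rewrite mulr_suml.
by apply: ler_sum => j _; rewrite normrM ler_wpM2l //; apply: kmax.
Qed.

Section Laplacian.
Variables (R : rcfType) (n : nat) (e : rel 'I_n).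
Hypotheses (e_sym : symmetric e) (e_irr : irreflexive e).

Local Notation L := (laplacian_mx R e).

Lemma natr_degree (i : 'I_n) : (degree e i)%:R = \sum_j (e i j)%:R :> R.
Proof.
rewrite /degree cardsE -sum1_card natr_sum big_mkcond /=.
by apply: eq_bigr => j _; rewrite unfold_in /=; case: ifP.
Qed.

Lemma laplacian_mxE (i j : 'I_n) :
  L i j = (degree e i)%:R *+ (i == j) - (e i j)%:R.
Proof. by rewrite !mxE. Qed.

Lemma laplacian_row_sum (i : 'I_n) : \sum_j L i j = 0.
Proof.
under eq_bigr do rewrite laplacian_mxE.
rewrite sumrB (bigD1 i) //= eqxx mulr1n big1 ?addr0 ?natr_degree ?subrr //.
by move=> j; rewrite eq_sym => /negbTE ->.
Qed.

(** The Gershgorin interval of row [k] has centre and radius both equal to the degree of [k], so it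
    starts at 0. *)
Lemma laplacian_eigenvalue_ge0 (x : R) : root (char_poly L) x -> 0 <= x.
Proof.
case/Gershgorin=> k; rewrite laplacian_mxE eqxx e_irr subr0 mulr1n natr_degree.
rewrite [X in x - X](bigD1 k) //= e_irr add0r.
rewrite [leRHS](eq_bigr (fun j => (e k j)%:R)) => [|j jk]; last first.
  by rewrite laplacian_mxE eq_sym (negbTE jk) add0r normrN normr_nat.
by rewrite ler_norml => /andP[]; lra.
Qed.

(** Both sides count the symmetric difference of the two neighbourhoods. *)
Lemma sum_norm_nbrs_diff (i k : 'I_n) :
  \sum_j `|(e i j)%:R - (e k j)%:R|
    = (degree e i)%:R + (degree e k)%:R - 2 * (common_nbrs e i k)%:R :> R.
Proof.
have -> : (common_nbrs e i k)%:R = \sum_j (e i j && e k j)%:R :> R.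
  rewrite /common_nbrs cardsE -sum1_card natr_sum big_mkcond /=.
  by apply: eq_bigr => j _; rewrite unfold_in /=; case: ifP.
rewrite !natr_degree mulr_sumr -big_split -sumrB /=.
apply: eq_bigr => j _; case: (e i j) (e k j) => [] [] /=;
  by rewrite ?subrr ?subr0 ?sub0r ?normrN ?normr0 ?normr1; ring.
Qed.

Lemma sum_norm_nbrs_diff_off (i k : 'I_n) : k != i ->
  \sum_(j | (j != i) && (j != k)) `|(e i j)%:R - (e k j)%:R|
    = (degree e i)%:R + (degree e k)%:R - 2 * (common_nbrs e i k)%:R
      - 2 * (e k i)%:R :> R.
Proof.
(* The omitted terms [j = i] and [j = k] each equal 1 exactly when [i] and [k] are adjacent. *)
move=> ki; rewrite -sum_norm_nbrs_diff [X in X - _](bigD1 i) //=.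
rewrite [X in _ + X - _](bigD1 k) //=.
rewrite !e_irr (e_sym i k) sub0r subr0 normrN normr_nat.
by ring.
Qed.

End Laplacian.

Section Eigenvalues.
Variables (R : rcfType) (n : nat) (e : rel 'I_n.+1).
Hypotheses (e_sym : symmetric e) (e_irr : irreflexive e).
Variable lambda : n.+1.-tuple R.
Hypothesis lambda_eig : eigenvalues_of (laplacian_mx R e) lambda.

Local Notation L := (laplacian_mx R e).

Lemma laplacian_reduced_root (i : 'I_n.+1) (m : nat) : (m < n)%N ->
  root (char_poly (\matrix_(k, j) (L (lift i k) (lift i j) - L i (lift i j))))
    lambda`_m.
Proof.
move=> m_lt_n; case: lambda_eig => lam_sorted.
have lam_ge0 x : x \in (lambda : seq R) -> 0 <= x.
  move=> x_lam; apply: (laplacian_eigenvalue_ge0 e_irr).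
  by case: lambda_eig => _ ->; rewrite root_prod_XsubC.
rewrite (char_poly_row_sum0 i (laplacian_row_sum R e)) => charE.
(* 0 occurs somewhere in the list; the last entry is no larger, and no entry is negative. *)
have lam_n : lambda`_n = 0.
  have: root (\prod_(x <- lambda) ('X - x%:P)) 0.
    by rewrite -charE rootM rootX eqxx.
  rewrite root_prod_XsubC => /(nthP 0)[j]; rewrite size_tuple ltnS => j_le_n lam_j.
  apply: le_anti; rewrite lam_ge0 ?mem_nth ?size_tuple // andbT -[leRHS]lam_j.
  by apply: (sorted_leq_nth ge_trans ge_refl 0 lam_sorted);
    rewrite ?inE ?size_tuple ?ltnS.
(* Cancelling ['X] against the last factor leaves the product over the first [n] entries. *)
move: charE; rewrite (big_nth 0) size_tuple big_mkord big_ord_recr /= lam_n.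
rewrite subr0 mulrC => /(mulIf (negbT (polyX_eq0 R))) ->.
rewrite (bigD1 (Ordinal m_lt_n)) //= rootM.
by rewrite root_XsubC eqxx.
Qed.

Lemma laplacian_eigenvalue_bounds (i : 'I_n.+1) (m : nat) : (m < n)%N ->
  exists2 k, k != i & alpha R e i k <= lambda`_m <= beta R e i k.
Proof.
move=> m_lt_n.
have /Gershgorin[k0] := laplacian_reduced_root i m_lt_n.
set k := lift i k0; have ki : k != i by rewrite eq_sym neq_lift.
have ik : i != k by rewrite eq_sym.
rewrite mxE (_ : \sum_(j | j != k0) _ =
    \sum_(j | (j != i) && (j != k)) `|(e i j)%:R - (e k j)%:R|); last first.
  rewrite [RHS]big_mkcond (bigD1_ord i) //= eqxx add0r -big_mkcond /=.
  apply: eq_big => [j|j jk0].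
    by rewrite (inj_eq lift_inj) [lift i j == i]eq_sym neq_lift.
  rewrite mxE !laplacian_mxE (inj_eq lift_inj) [k0 == j]eq_sym (negbTE jk0).
  by rewrite (negbTE (neq_lift _ _)) !sub0r opprK addrC.
rewrite sum_norm_nbrs_diff_off // !laplacian_mxE eqxx (negbTE ik) e_irr.
rewrite (e_sym i k) !mulr1n mulr0n subr0 sub0r opprK ler_norml => bounds.
(* With a = 1 for adjacent [i], [k] and a = 0 otherwise, the centre is d_k + a and the radius d_i +
   d_k - 2N(i,k) - 2a. The upper end is exactly [beta]; the lower end is -d_i + 2N(i,k) + 3a, which
   exceeds [alpha] by 2a. *)
exists k => //; move: bounds; rewrite /alpha /beta.
by case: (e k i) => /= /andP[lo hi]; apply/andP; split; lra.
Qed.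

End Eigenvalues.

Theorem theorem5p4 (R : rcfType) (n : nat) (n_gt1 : (1 < n)%N)
    (e : rel 'I_n) (e_sym : symmetric e) (e_irr : irreflexive e)
    (e_conn : connected_graph e)
    (lambda : n.-tuple R)
    (lambda_eig : eigenvalues_of (laplacian_mx R e) lambda) :
  (* [lambda`_j] is 0-indexed: it is the (j+1)-st largest eigenvalue *)
  [/\ fin_max predT (fun i => fin_min (fun k => k != i) (fun k => alpha R e i k))
        <= lambda`_(n - 2),
      lambda`_(n - 2) <= lambda`_0
    & lambda`_0
        <= fin_min predT
             (fun i => fin_max (fun k => k != i) (fun k => beta R e i k))].
Proof.
case: n => [|[|n]] // in n_gt1 e e_sym e_irr e_conn lambda lambda_eig *.
rewrite !subSS subn0.
have bounds i m := @laplacian_eigenvalue_bounds _ _ _ e_sym e_irr _ lambda_eig i m.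
split.
(* Take [i] attaining the outer maximum; the [k] supplied by [bounds] need not attain the inner
   minimum, but its [alpha] lies above it. The list now has length [n.+2], so index [n] is the
   second smallest eigenvalue. *)
- have [[i _ ->] _] := fin_maxP
    (fun i => fin_min (fun k => k != i) (fun k => alpha R e i k)) (erefl (predT ord0)).
  have [k ki /andP[le_lam _]] := bounds i n (ltnSn n).
  apply: le_trans le_lam.
  by have [_] := @fin_minP R _ (fun k => k != i) (alpha R e i) k ki; apply.
- have [lam_sorted _] := lambda_eig.
  apply: (sorted_leq_nth ge_trans ge_refl 0 lam_sorted);
    by rewrite ?inE ?size_tuple.
have [[i _ ->] _] := fin_minP
  (fun i => fin_max (fun k => k != i) (fun k => beta R e i k)) (erefl (predT ord0)).
have [k ki /andP[_ lam_le]] := bounds i 0%N (ltn0Sn n).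
apply: (le_trans lam_le).
by have [_] := @fin_maxP R _ (fun k => k != i) (beta R e i) k ki; apply.
Qed.
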